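(* Let $M$ be a $\lambda$-term, let $(\Pi,E)$ be a pseudo-derivation for $M$, let $(\bar{\mathsf e},\psi)$ be a solution of $(\Pi,E)$, and suppose that the root of $\bar{\mathsf e}(\Pi)$ is the judgement $\mathtt{\Gamma}\vdash_{\tt p} M:{\tt a}$. Then for every substitution $\phi:\mathbf V\to\mathbf T$, the tree $\phi\circ\mathsf m\circ\psi\circ\bar{\mathsf e}(\Pi)$ is a derivation in system $\mathcal N$ of the judgement $\phi(\mathsf m(\psi(\mathtt{\Gamma})))\vdash M:\phi(\mathsf m(\psi({\tt a})))$.
   Context: $\lambda$-terms: $M,N::=x\mid\lambda x.M\mid MN$. Intersection types $\mathbf T$: $A::=a\mid\mu\to A$, with $a$ in a countable set $\mathbf V$ of type variables and $\mu=[A_1,\dots,A_n]$ ($n\ge0$) a finite multiset of types. A type environment $\Gamma$ maps term variables to multisets, all but finitely many to $[\,]$; $\mathrm{dom}(\Gamma)=\{x\mid\Gamma(x)\neq[\,]\}$; $(\Gamma\uplus\Delta)(x)=\Gamma(x)\uplus\Delta(x)$ (multiset union); $\Gamma\setminus x$ agrees with $\Gamma$ except that it maps $x$ to $[\,]$. System $\mathcal N$ has rules: (var) $x:[A]\vdash x:A$; (abs) from $\Gamma\vdash M:A$ infer $\Gamma\setminus x\vdash\lambda x.M:\Gamma(x)\to A$; (many) from $\Gamma_i\vdash M:A_i$ ($1\le i\le n$, $n\ge0$) infer $\biguplus_i\Gamma_i\vdash M:[A_1,\dots,A_n]$; (app) from $\Gamma\vdash M:\mu\to A$ and $\Delta\vdash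 N:\mu$ infer $\Gamma\uplus\Delta\vdash MN:A$. Pre-types: ${\tt A}::={\tt a}\mid\sigma\to{\tt A}$, with ${\tt a}$ in a countable set $\mathbf V_{\tt p}$ of pre-type variables and $\sigma=\langle{\tt A}_1,\dots,{\tt A}_n\rangle$ ($n\ge0$) a finite ordered list; $|\sigma|$ is its length, $\cdot$ is concatenation. Pre-type environments $\mathtt\Gamma$ map term variables to lists (all but finitely many empty), with pointwise concatenation $\mathtt\Gamma\cdot\mathtt\Delta$ and the analogous notations $\mathrm{dom}$, $\mathtt\Gamma\setminus x$. Objects are disjoint if they share no pre-type variable; fresh means occurring nowhere else. A pseudo-derivation for $M$ is a pair $(\Pi,E_\Pi)$, $\Pi$ a tree with ordered premises and $E_\Pi$ a set of equations between pre-types or between lists, built by: (var) $x:\langle{\tt a}\rangle\vdash_{\tt p}x:{\tt a}$, $E=\emptyset$; (abs) from $\Sigma\triangleright\mathtt\Gamma\vdash_{\tt p}M:{\tt a}$, ${\tt b}$ fresh, infer $\mathtt\Gamma\setminus x\vdash_{\tt p}\lambda x.M:{\tt b}$, $E=E_\Sigma\cup\{{\tt b}\doteq\mathtt\Gamma(x)\to{\tt a}\}$; (many) from pairwise disjoint $\Sigma_i\triangleright\mathtt\Gamma_i\vdash_{\tt p}M:{\tt a}_i$ ($1\le i\le n$, $n\ge0$) infer $\mathtt\Gamma_1\cdot\ldots\cdot\mathtt\Gamma_n\vdash_{\tt p}M:\langle{\tt a}_1,\dots,{\tt a}_n\rangle$, $E=\bigcup_iE_{\Sigma_i}$; (app)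 from disjoint $\Sigma_1\triangleright\mathtt\Gamma\vdash_{\tt p}M:{\tt a}$ and $\Sigma_2\triangleright\mathtt\Delta\vdash_{\tt p}N:\langle{\tt b}_1,\dots,{\tt b}_n\rangle$, ${\tt c}$ fresh, infer $\mathtt\Gamma\cdot\mathtt\Delta\vdash_{\tt p}MN:{\tt c}$, $E=E_{\Sigma_1}\cup E_{\Sigma_2}\cup\{{\tt a}\doteq\langle{\tt b}_1,\dots,{\tt b}_n\rangle\to{\tt c}\}$. Pseudo-derivations are taken modulo renaming of pre-type variables. The minimal pseudo-derivation $\mathrm{PD}_{\min}(M)$ is the one with $n=1$ in every (many) rule. A substitution $\psi:\mathbf V_{\tt p}\to$ pre-types (resp. $\phi:\mathbf V\to\mathbf T$) is extended homomorphically to lists, environments and trees; $\psi$ solves a set of equations if it makes both sides of each equation equal. The map $\mathsf m$ sends pre-types to types: $\mathsf m({\tt a})=a$ (injective on variables), $\mathsf m(\sigma\to{\tt A})=\mathsf m(\sigma)\to\mathsf m({\tt A})$, $\mathsf m(\langle{\tt A}_1,\dots,{\tt A}_n\rangle)=[\mathsf m({\tt A}_1),\dots,\mathsf m({\tt A}_n)]$, extended to environments and trees. Expansion $\mathsf{Exp}(\sigma,n)$ ($\sigma\neq\langle\rangle$, $n\ge1$): if $\sigma=\langle{\tt a}_1,\dots,{\tt a}_m\rangle$ is the list in the conclusion of a (many) rule of $\Pi$ with subject $N$, replace the subtree rooted there by a (many) rule whose $m+n$ premises are fresh pairwise disjoint copies $\Sigma_i\triangleright\mathtt\Gamma_i\vdash_{\tt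 p}N:{\tt a}_i$ ($1\le i\le m+n$) of $\mathrm{PD}_{\min}(N)$, recomputing the equations; otherwise leave $\Pi$ unchanged. Erasure $\mathsf{Er}(\sigma,n)$: the same, but with $\max(m-n,0)$ such premises. A solution of a pseudo-derivation $(\Pi,E)$ is a pair $(\bar{\mathsf e},\psi)$ where $\bar{\mathsf e}$ is a finite sequence of expansions and erasures and $\psi$ solves the equation set of $\bar{\mathsf e}(\Pi,E)$. *)

(* Defs.v *)
From Stdlib Require List.
From HB Require Import structures.
From mathcomp Require Import all_boot.
From mathcomp Require Import finmap multiset.

Set Implicit Arguments.
Unset Strict Implicit.
Unset Printing Implicit Defensive.

Local Open Scope fset_scope.
Local Open Scope mset_scope.

Definition var := nat.

Inductive term := Var of var | Lam of var & term | App of term & term.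

Fixpoint term_enc (M : term) : GenTree.tree var :=
  match M with
  | Var x => GenTree.Leaf x
  | Lam x M => GenTree.Node 0 [:: GenTree.Leaf x; term_enc M]
  | App M N => GenTree.Node 1 [:: term_enc M; term_enc N]
  end.

Fixpoint term_dec (t : GenTree.tree var) : term :=
  match t with
  | GenTree.Leaf x => Var x
  | GenTree.Node 0 [:: GenTree.Leaf x; t] => Lam x (term_dec t)
  | GenTree.Node _ [:: t; u] => App (term_dec t) (term_dec u)
  | _ => Var 0
  end.

Lemma term_encK : cancel term_enc term_dec.
Proof. by elim=> [x|x M IH|M IHM N IHN] //=; rewrite ?IH ?IHM ?IHN. Qed.

HB.instance Definition _ := Countable.copy term (can_type term_encK).

(* Arrow types with lists to the left of the arrow.  They are the pre-types
   when [V] is [pvar]; over [tvar] they are the raw syntax from which types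
   are obtained by forgetting the order in lists, hereditarily. *)
Inductive lty (V : Type) := LVar of V | LArr of seq (lty V) & lty V.

Lemma lty_ind_Forall (V : eqType) (P : lty V -> Prop) :
  (forall a, P (LVar a)) ->
  (forall s A, List.Forall P s -> P A -> P (LArr s A)) ->
  forall A, P A.
Proof.
move=> Pv Pa; fix IH 1; case=> [a|s A]; first exact: Pv.
apply: Pa (IH A); elim: s => [|B s IHs]; first exact: List.Forall_nil.
exact: List.Forall_cons (IH B) IHs.
Qed.

Fixpoint lty_enc V (A : lty V) : GenTree.tree V :=
  match A with
  | LVar a => GenTree.Leaf a
  | LArr s A => GenTree.Node 0 (lty_enc A :: map (@lty_enc V) s)
  end.

Fixpoint lty_dec V (t : GenTree.tree V) : option (lty V) :=
  match t with
  | GenTree.Leaf a => Some (LVar a)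
  | GenTree.Node _ ts =>
      if pmap (@lty_dec V) ts is A :: s then Some (LArr s A) else None
  end.

Lemma lty_encK (V : eqType) : pcancel (@lty_enc V) (@lty_dec V).
Proof.
elim/lty_ind_Forall => [a|s A IHs IHA] //=; rewrite IHA /=.
suff -> : pmap (@lty_dec V) (map (@lty_enc V) s) = s by [].
by elim: {A IHA} IHs => //= B t -> _ /= ->.
Qed.

HB.instance Definition _ (V : countType) :=
  Countable.copy (lty V) (pcan_type (@lty_encK V)).

Definition pvar := nat.
Definition pty := lty pvar.

HB.instance Definition _ := Countable.on pty.

(* A type is a raw type whose lists are hereditarily sorted along an arbitrary
   fixed total order.  Thus [arr : {mset ty} -> ty -> ty] below takes a
   genuine multiset, and [tv] and [arr] are free constructors of [ty]: see
   [tv_inj], [arr_inj], [tv_neq_arr] and [ty_ind]. *)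

Definition tvar := nat.

Definition lty_le : rel (lty tvar) := fun A B => choice.pickle A <= choice.pickle B.

Fixpoint nf (A : lty tvar) : lty tvar :=
  match A with
  | LVar a => LVar a
  | LArr s A => LArr (sort lty_le (map nf s)) (nf A)
  end.

Definition ty := {A : lty tvar | nf A == A}.

HB.instance Definition _ := Countable.on ty.

Definition tv (a : tvar) : ty :=
  exist (fun B => nf B == B) (LVar a) (eqxx _).

Lemma lty_le_total : total lty_le.
Proof. by move=> A B; exact: leq_total. Qed.

Lemma lty_le_trans : transitive lty_le.
Proof. by move=> A B C; exact: leq_trans. Qed.

Lemma lty_le_anti : antisymmetric lty_le.
Proof.
by move=> A B; rewrite /lty_le -eqn_leq => /eqP; exact: (pcan_inj choice.pickleK).
Qed.

Lemma nf_idem A : nf (nf A) = nf A.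
Proof.
elim/lty_ind_Forall: A => [a|s A IHs IHA] //=; rewrite IHA; congr (LArr _ _).
have nfs : map nf (map nf s) = map nf s.
  by elim: {A IHA} IHs => //= B t -> _ ->.
have {}nfs : {in sort lty_le (map nf s), forall B, nf B = B}.
  move=> B; rewrite mem_sort => /mapP[C sC ->].
  by elim: {IHs IHA} s nfs sC => //= D t IH [D1 /IH{}IH] /[1!inE] /predU1P[->|/IH].
rewrite (map_id_in nfs) sorted_sort ?(sort_sorted lty_le_total) //.
exact: lty_le_trans.
Qed.

Lemma nf_sort_val (s : seq ty) :
  map nf (sort lty_le (map val s)) = sort lty_le (map val s).
Proof.
apply/map_id_in => A; rewrite mem_sort => /mapP[B _ ->].
exact/eqP/(valP B).
Qed.

Lemma arr_subproof (mu : {mset ty}) (A : ty) :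
  let B := LArr (sort lty_le (map val (mu : seq ty))) (val A) in nf B == B.
Proof.
rewrite /= nf_sort_val (eqP (valP A)) sorted_sort //; last first.
  exact: (sort_sorted lty_le_total).
exact: lty_le_trans.
Qed.

Definition arr (mu : {mset ty}) (A : ty) : ty :=
  exist (fun B => nf B == B) _ (arr_subproof mu A).

Lemma tv_inj : injective tv.
Proof. by move=> a b []. Qed.

Lemma tv_neq_arr a mu A : tv a <> arr mu A.
Proof. by []. Qed.

Lemma arr_inj mu nu A B : arr mu A = arr nu B -> mu = nu /\ A = B.
Proof.
move=> /(congr1 val) /= [E /val_inj ->]; split=> //.
rewrite -[mu]seq_mset_id -[nu]seq_mset_id; apply/eq_seq_msetP.
apply: (perm_map_inj val_inj).
by rewrite -(perm_sort lty_le) E perm_sort.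
Qed.

Lemma ty_ind (P : ty -> Prop) :
  (forall a, P (tv a)) ->
  (forall (mu : {mset ty}) A, (forall B, B \in mu -> P B) -> P A -> P (arr mu A)) ->
  forall A, P A.
Proof.
move=> Pv Pa [A nA]; elim/lty_ind_Forall: A nA => [a|s A IHs IHA] nA.
  by rewrite (_ : exist (fun B => nf B == B) _ nA = tv a) //; exact: val_inj.
have /eqP[Es EA] := nA.
have nfs : all (fun B => nf B == B) s.
  apply/allP => B; rewrite -Es mem_sort => /mapP[C _ ->].
  by rewrite nf_idem.
have nfA : nf A == A by rewrite EA.
pose t : seq ty := pmap insub s.
have valt : map val t = s.
  rewrite (pmap_filter (insubK _)); apply/all_filterP.
  by apply: sub_all nfs => B; rewrite /= isSome_insub.
have srt : sorted lty_le s by rewrite -Es (sort_sorted lty_le_total).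
rewrite (_ : exist (fun B => nf B == B) _ nA = arr (seq_mset t) (exist (fun B => nf B == B) A nfA)); last first.
  apply: val_inj => /=; congr (LArr _ _).
  rewrite -[LHS](sorted_sort lty_le_trans srt) -valt.
  apply/(perm_sortP lty_le_total lty_le_trans lty_le_anti).
  by rewrite perm_map // perm_sym perm_eq_seq_mset.
apply: Pa => [B|]; last exact: IHA.
rewrite (perm_mem (perm_eq_seq_mset _)) => tB.
have {tB} : val B \in s by rewrite -valt map_f.
case: B => B nB /=; elim: {nA Es t valt srt nfs} IHs => //= C u IHC _ IHu.
by rewrite inE => /predU1P[E|/IHu//]; subst C; exact: IHC.
Qed.

Definition env (V : eqType) (d : V) := {fsfun var -> V with d}.

Definition env0 (V : eqType) (d : V) : env d := [fsfun].

Definition env1 (V : eqType) (d : V) x v : env d := [fsfun env0 d with x |-> v].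

Definition env_rem (V : eqType) (d : V) (G : env d) x : env d :=
  [fsfun G without x].

(* Pointwise operations; meaningful when [op d d = d], resp. [f d = d']. *)
Definition env_op (V : eqType) (d : V) (op : V -> V -> V) (G D : env d) :
    env d :=
  [fsfun x in (finsupp G `|` finsupp D)%fset => op (G x) (D x)].

Definition env_map (V W : eqType) (d : V) (d' : W) (f : V -> W) (G : env d) :
    env d' :=
  [fsfun x in finsupp G => f (G x)].

Definition penv := env ([::] : seq pty).
Definition penv_cat : penv -> penv -> penv := env_op cat.
Definition penv_cats : seq penv -> penv := foldr penv_cat (env0 [::]).

Definition nenv := env (mset0 : {mset ty}).
Definition nenv_sum : nenv -> nenv -> nenv := env_op msetD.
Definition nenv_sums : seq nenv -> nenv := foldr nenv_sum (env0 mset0).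

(* [inl] in the third component is a judgement assigning a single (pre-)type,
   [inr] one assigning a list or a multiset. *)
Record judgement (E T L : Type) := Judg {jenv : E; jsubj : term; jres : T + L}.

Inductive tree (J : Type) := Node of J & seq (tree J).

Definition concl J (t : tree J) := let: Node j _ := t in j.

Fixpoint tree_map J J' (f : J -> J') (t : tree J) : tree J' :=
  let: Node j ts := t in Node (f j) (map (tree_map f) ts).

Fixpoint tree_has J (p : pred J) (t : tree J) : bool :=
  let: Node j ts := t in p j || has (tree_has p) ts.

Definition jmap E T L E' T' L' (fE : E -> E') (fT : T -> T') (fL : L -> L')
    (j : judgement E T L) : judgement E' T' L' :=
  Judg (fE (jenv j)) (jsubj j)
       match jres j with inl A => inl (fT A) | inr s => inr (fL s) end.

Definition pjudg := judgement penv pty (seq pty).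
Definition ptree := tree pjudg.

Definition njudg := judgement nenv ty {mset ty}.
Definition ntree := tree njudg.

Inductive derivation : ntree -> Prop :=
| N_var x A :
    derivation (Node (Judg (env1 mset0 x [mset A]) (Var x) (inl A)) [::])
| N_abs (G : nenv) x M A t :
    derivation t -> concl t = Judg G M (inl A) ->
    derivation
      (Node (Judg (env_rem G x) (Lam x M) (inl (arr (G x) A))) [:: t])
| N_many M (GAs : seq (nenv * ty)) (ts : seq ntree) :
    List.Forall derivation ts ->
    map (@concl _) ts = [seq Judg GA.1 M (inl GA.2) | GA <- GAs] ->
    derivation
      (Node (Judg (nenv_sums (unzip1 GAs)) M (inr (seq_mset (unzip2 GAs)))) ts)
| N_app (G D : nenv) M N mu A t u :
    derivation t -> concl t = Judg G M (inl (arr mu A)) ->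
    derivation u -> concl u = Judg D N (inr mu) ->
    derivation (Node (Judg (nenv_sum G D) (App M N) (inl A)) [:: t; u]).

Fixpoint pty_vars (A : pty) : seq pvar :=
  match A with
  | LVar a => [:: a]
  | LArr s B => flatten (map pty_vars s) ++ pty_vars B
  end.

Definition ptys_vars (s : seq pty) : seq pvar := flatten (map pty_vars s).

Definition pjudg_vars (j : pjudg) : seq pvar :=
  flatten [seq ptys_vars (jenv j x) | x <- finsupp (jenv j)] ++
  match jres j with inl A => pty_vars A | inr s => ptys_vars s end.

Fixpoint ptree_vars (P : ptree) : seq pvar :=
  let: Node j Ps := P in pjudg_vars j ++ flatten (map ptree_vars Ps).

Definition disjoint_ptrees (P Q : ptree) : bool :=
  ~~ has (fun a => a \in ptree_vars P) (ptree_vars Q).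

Inductive pseudo : ptree -> Prop :=
| P_var x a :
    pseudo (Node (Judg (env1 [::] x [:: LVar a]) (Var x) (inl (LVar a))) [::])
| P_abs (G : penv) x M a b P :
    pseudo P -> concl P = Judg G M (inl (LVar a)) ->
    b \notin ptree_vars P ->
    pseudo (Node (Judg (env_rem G x) (Lam x M) (inl (LVar b))) [:: P])
| P_many M (Gas : seq (penv * pvar)) (Ps : seq ptree) :
    List.Forall pseudo Ps -> pairwise disjoint_ptrees Ps ->
    map (@concl _) Ps = [seq Judg Ga.1 M (inl (LVar Ga.2)) | Ga <- Gas] ->
    pseudo (Node (Judg (penv_cats (unzip1 Gas)) M
                       (inr (map (@LVar _) (unzip2 Gas)))) Ps)
| P_app (G D : penv) M N a bs c P Q :
    pseudo P -> concl P = Judg G M (inl (LVar a)) ->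
    pseudo Q -> concl Q = Judg D N (inr (map (@LVar _) bs)) ->
    disjoint_ptrees P Q -> c \notin ptree_vars P -> c \notin ptree_vars Q ->
    pseudo (Node (Judg (penv_cat G D) (App M N) (inl (LVar c))) [:: P; Q]).

(* Equations between pre-types ([inl]) or between lists ([inr]). *)
Definition equation := ((pty * pty) + (seq pty * seq pty))%type.

Definition eqset := {fset equation}.

Definition rule_eqs (j : pjudg) (js : seq pjudg) : eqset :=
  match jsubj j, jres j, js with
  | Lam x _, inl b, [:: Judg G _ (inl a)] =>
      [fset inl (b, LArr (G x) a)]
  | App _ _, inl c, [:: Judg _ _ (inl a); Judg _ _ (inr s)] =>
      [fset inl (a, LArr s c)]
  | _, _, _ => fset0
  end.

Fixpoint equations (P : ptree) : eqset :=
  let: Node j Ps := P in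
  foldr (fun Q E => (equations Q `|` E)%fset) (rule_eqs j (map (@concl _) Ps)) Ps.

Definition pseudo_derivation (M : term) (PE : ptree * eqset) : Prop :=
  [/\ pseudo PE.1, jsubj (concl PE.1) = M & PE.2 = equations PE.1].

Section PSubst.
Variable psi : pvar -> pty.

Fixpoint psubst (A : pty) : pty :=
  match A with
  | LVar a => psi a
  | LArr s B => LArr (map psubst s) (psubst B)
  end.

Definition penv_subst : penv -> penv := env_map [::] (map psubst).

Definition ptree_subst : ptree -> ptree :=
  tree_map (jmap penv_subst psubst (map psubst)).

Definition equation_subst (e : equation) : equation :=
  match e with
  | inl (A, B) => inl (psubst A, psubst B)
  | inr (s, t) => inr (map psubst s, map psubst t)
  end.

Definition solves (E : eqset) : Prop :=
  forall e, e \in E ->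
  match equation_subst e with inl (A, B) => A = B | inr (s, t) => s = t end.

End PSubst.

(* A renaming of the finitely many variables of a tree extends to an injection
   of [pvar]. *)
Definition renaming (PE QF : ptree * eqset) : Prop :=
  exists r : pvar -> pvar, injective r /\
  QF = (ptree_subst (@LVar _ \o r) PE.1,
        [fset equation_subst (@LVar _ \o r) e | e in PE.2]).

(* [is_many s N j]: [j] is the conclusion of a (many) rule, with list [s] and
   subject [N]. *)
Definition is_many (s : seq pty) (N : term) (j : pjudg) : bool :=
  (jsubj j == N) && (if jres j is inr t then t == s else false).

Fixpoint minimal (P : ptree) : bool :=
  let: Node j Ps := P in
  (if jres j is inr _ then size Ps == 1 else true) && all minimal Ps.

(* [P] is a representative, modulo renaming, of the minimal pseudo-derivation
   for [N]; it ends with a judgement assigning a pre-type. *)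
Definition is_PDmin (N : term) (P : ptree) : Prop :=
  [/\ pseudo P, minimal P & exists G a, concl P = Judg G N (inl (LVar a))].

(* The conclusion of a (many) rule with subject [M] and premises [js]. *)
Definition many_judg (M : term) (js : seq pjudg) : pjudg :=
  Judg (penv_cats (map (@jenv _ _ _) js)) M
       (inr (pmap (fun j => if jres j is inl A then Some A else None) js)).

(* The conclusion obtained from new premises [js] by the same rule as [j],
   keeping the pre-type variable introduced by this rule. *)
Definition rule_judg (j : pjudg) (js : seq pjudg) : pjudg :=
  match jsubj j, jres j, js with
  | Lam x M, inl b, [:: j1] => Judg (env_rem (jenv j1) x) (Lam x M) (inl b)
  | App M N, inl c, [:: j1; j2] =>
      Judg (penv_cat (jenv j1) (jenv j2)) (App M N) (inl c)
  | M, inr _, _ => many_judg M js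
  | _, _, _ => j
  end.

(* Replaces by [Ps] the premises of the (many) rule concluding with [s] and
   [N], and recomputes the conclusions of the rules below. *)
Fixpoint graft (s : seq pty) (N : term) (Ps : seq ptree) (P : ptree) : ptree :=
  let: Node j Qs := P in
  if is_many s N j then Node (many_judg N (map (@concl _) Ps)) Ps
  else let Qs' := map (graft s N Ps) Qs in
       Node (rule_judg j (map (@concl _) Qs')) Qs'.

Inductive operation := Exp of seq pty & nat | Er of seq pty & nat.

Definition op_list (o : operation) := match o with Exp s _ | Er s _ => s end.

Definition op_wf (o : operation) : bool :=
  match o with Exp s n | Er s n => (s != [::]) && (0 < n) end.

Definition op_size (o : operation) : nat :=
  match o with Exp s n => size s + n | Er s n => size s - n end.

(* [apply_op o PE QF]: [QF] is a result of applying [o] to [PE], for some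
   choice of the fresh variables. *)
Inductive apply_op (o : operation) (PE : ptree * eqset) :
    ptree * eqset -> Prop :=
| Op_replace N (Ps : seq ptree) :
    tree_has (is_many (op_list o) N) PE.1 ->
    size Ps = op_size o ->
    List.Forall (is_PDmin N) Ps ->
    pairwise disjoint_ptrees Ps -> all (disjoint_ptrees PE.1) Ps ->
    let Q := graft (op_list o) N Ps PE.1 in
    apply_op o PE (Q, equations Q)
| Op_unchanged :
    (forall N, ~~ tree_has (is_many (op_list o) N) PE.1) ->
    apply_op o PE PE.

Inductive apply_ops : seq operation ->
    ptree * eqset -> ptree * eqset -> Prop :=
| Ops_nil PE QF : renaming PE QF -> apply_ops [::] PE QF
| Ops_cons o os PE PE' QF :
    apply_op o PE PE' -> apply_ops os PE' QF -> apply_ops (o :: os) PE QF.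

(* [(os, psi)] is a solution of [PE], where [QF] is the representative of
   [os PE] whose equations are solved by [psi]. *)
Definition solution (PE : ptree * eqset) (os : seq operation)
    (psi : pvar -> pty) (QF : ptree * eqset) : Prop :=
  [/\ all op_wf os, apply_ops os PE QF & solves psi QF.2].

Section Forget.
(* The correspondence between pre-type variables and type variables. *)
Variable iota : pvar -> tvar.

Fixpoint forget (A : pty) : ty :=
  match A with
  | LVar a => tv (iota a)
  | LArr s B => arr (seq_mset (map forget s)) (forget B)
  end.

Definition forget_list (s : seq pty) : {mset ty} := seq_mset (map forget s).

Definition forget_env : penv -> nenv := env_map mset0 forget_list.

Definition forget_tree : ptree -> ntree :=
  tree_map (jmap forget_env forget forget_list).

End Forget.

Section TSubst.
Variable phi : tvar -> ty.

Fixpoint lty_subst (A : lty tvar) : ty :=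
  match A with
  | LVar a => phi a
  | LArr s B => arr (seq_mset (map lty_subst s)) (lty_subst B)
  end.

Definition tsubst (A : ty) : ty := lty_subst (val A).

Definition mset_subst (mu : {mset ty}) : {mset ty} :=
  seq_mset (map tsubst (mu : seq ty)).

Lemma tsubst_tv a : tsubst (tv a) = phi a.
Proof. by []. Qed.

Lemma tsubst_arr mu A : tsubst (arr mu A) = arr (mset_subst mu) (tsubst A).
Proof.
congr (arr _ _); apply/eq_seq_msetP.
by rewrite /tsubst (map_comp lty_subst val) perm_map // perm_sort.
Qed.

Definition nenv_subst : nenv -> nenv := env_map mset0 mset_subst.

Definition ntree_subst : ntree -> ntree :=
  tree_map (jmap nenv_subst tsubst mset_subst).

End TSubst.

(* Main.v *)
Require Import Defs.
From Stdlib Require List.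
From mathcomp Require Import all_boot.
From mathcomp Require Import finmap multiset.

Set Implicit Arguments.
Unset Strict Implicit.
Unset Printing Implicit Defensive.

Local Open Scope fset_scope.
Local Open Scope mset_scope.

(** Disjointness and freshness play no role: it is enough that every node of
    the tree is an instance of a rule of pseudo-derivations.  This local
    property is preserved by expansion and erasure, because replacing the
    premises of a (many) rule changes, below it, only environments and the
    lists assigned to arguments.  A substitution that solves the equations
    then turns each node into an instance of the homonymous rule of system N,
    the equations of (abs) and (app) being exactly the arrow constraints. *)

(** * Induction on trees, pointwise environments, and multisets of lists *)

Lemma tree_ind_Forall J (P : tree J -> Prop) :
  (forall j ts, List.Forall P ts -> P (Node j ts)) -> forall t, P t.
Proof.
move=> PN; fix IH 1; case=> j ts; apply: PN.
elim: ts => [|t ts IHts]; first exact: List.Forall_nil.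
exact: List.Forall_cons (IH t) IHts.
Qed.

Lemma Forall_imp2 T (P Q R : T -> Prop) s :
  (forall x, P x -> Q x -> R x) ->
  List.Forall P s -> List.Forall Q s -> List.Forall R s.
Proof.
move=> PQR Ps Qs; rewrite List.Forall_forall => x sx; apply: PQR.
  by move: Ps; rewrite List.Forall_forall; exact.
by move: Qs; rewrite List.Forall_forall; exact.
Qed.

Lemma concl_tree_map J J' (f : J -> J') t : concl (tree_map f t) = f (concl t).
Proof. by case: t. Qed.

Lemma tree_map_comp J J' J'' (f : J -> J') (g : J' -> J'') t :
  tree_map g (tree_map f t) = tree_map (g \o f) t.
Proof.
elim/tree_ind_Forall: t => j ts IH /=; congr Node.
by elim: IH => //= t {}ts -> _ ->.
Qed.

Lemma eq_tree_map J J' (f g : J -> J') : f =1 g -> tree_map f =1 tree_map g.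
Proof.
move=> fg; elim/tree_ind_Forall => j ts IH /=; rewrite fg; congr Node.
by elim: IH => //= t {}ts -> _ ->.
Qed.

Lemma env_mapE (V W : eqType) (d : V) (d' : W) (f : V -> W) (G : env d) x :
  f d = d' -> env_map d' f G x = f (G x).
Proof. by move=> fd; rewrite fsfunE; case: finsuppP => //; rewrite fd. Qed.

Lemma env_opE (V : eqType) (d : V) op (G D : env d) x :
  op d d = d -> env_op op G D x = op (G x) (D x).
Proof.
move=> opd; rewrite fsfunE in_fsetU.
by case: finsuppP => _ //; case: finsuppP.
Qed.

Lemma env1E (V : eqType) (d : V) x v y :
  env1 d x v y = if y == x then v else d.
Proof. by rewrite fsfun_withE fsfun0E. Qed.

Lemma env_remE (V : eqType) (d : V) (G : env d) x y :
  env_rem G x y = if y == x then d else G y.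
Proof. by rewrite fsfun_withE. Qed.

Lemma seq_mset_cat (K : choiceType) (s t : seq K) :
  seq_mset (s ++ t) = seq_mset s `+` seq_mset t.
Proof. by apply/msetP => x; rewrite msetE2 !mset_seqE count_cat. Qed.

Lemma seq_mset0 (K : choiceType) : seq_mset [::] = mset0 :> {mset K}.
Proof. by apply/msetP => x; rewrite mset_seqE mset0E. Qed.

(** * Rule instances and their stability under expansion and erasure *)

Inductive rule_instance : pjudg -> seq pjudg -> Prop :=
| R_var x a :
    rule_instance (Judg (env1 [::] x [:: LVar a]) (Var x) (inl (LVar a))) [::]
| R_abs (G : penv) x M a b :
    rule_instance (Judg (env_rem G x) (Lam x M) (inl (LVar b)))
                  [:: Judg G M (inl (LVar a))]
| R_many M (Gas : seq (penv * pvar)) :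
    rule_instance (Judg (penv_cats (unzip1 Gas)) M
                        (inr (map (@LVar _) (unzip2 Gas))))
                  [seq Judg Ga.1 M (inl (LVar Ga.2)) | Ga <- Gas]
| R_app (G D : penv) M N a bs c :
    rule_instance (Judg (penv_cat G D) (App M N) (inl (LVar c)))
                  [:: Judg G M (inl (LVar a));
                      Judg D N (inr (map (@LVar _) bs))].

Inductive locally_pseudo : ptree -> Prop :=
| Locally_pseudo j Ps :
    rule_instance j (map (@concl _) Ps) -> List.Forall locally_pseudo Ps ->
    locally_pseudo (Node j Ps).

Lemma locally_pseudo_inv j Ps :
  locally_pseudo (Node j Ps) ->
  rule_instance j (map (@concl _) Ps) /\ List.Forall locally_pseudo Ps.
Proof. by move=> H; inversion H. Qed.

(** The induction is on the tree, since the premises of (many) occur in [pseudo] nested under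
    [List.Forall]; [pseudo] itself is only inverted. *)
Lemma pseudo_locally P : pseudo P -> locally_pseudo P.
Proof.
elim/tree_ind_Forall: P => j Ps IH pP; suff [rP pPs] :
    rule_instance j (map (@concl _) Ps) /\ List.Forall pseudo Ps.
  by constructor=> //; apply: Forall_imp2 IH pPs => P; exact.
case EP: _ / pP => [x a|G x M a b P pP cP _|M Gas Qs pQs _ cQs|
    G D M N a bs c P Q pP cP pQ cQ _ _ _]; case: EP => -> -> /=.
- by split; [exact: R_var | exact: List.Forall_nil].
- by rewrite cP; split; [exact: R_abs | do !constructor].
- by rewrite cQs; split; [exact: R_many | ].
- by rewrite cP cQ; split; [exact: R_app | do !constructor].
Qed.

(** What grafting preserves at every node: environments may change, and a list may become another
    list of variables, but a single pre-type stays fixed. *)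
Definition same_kind (j j' : pjudg) : Prop :=
  jsubj j' = jsubj j /\
  match jres j with
  | inl A => jres j' = inl A
  | inr _ => exists bs, jres j' = inr (map (@LVar _) bs)
  end.

Lemma rule_many M (js : seq pjudg) Gas :
  js = [seq Judg Ga.1 M (inl (LVar Ga.2)) | Ga <- Gas] ->
  many_judg M js = Judg (penv_cats (unzip1 Gas)) M
                        (inr (map (@LVar _) (unzip2 Gas))).
Proof.
move=> ->; rewrite /many_judg -map_comp; congr (Judg _ _ (inr _)).
by elim: Gas => //= Ga Gas ->.
Qed.

(** A rule leaves the environments of its premises free, and (app) also the list assigned to its
    argument, so premises of the same kind still fit. The conclusion keeps its subject and, outside
    (many), its variable, so the rule below can be treated likewise. *)
Lemma rule_judg_instance j js js' :
  rule_instance j js -> List.Forall2 same_kind js js' ->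
  rule_instance (rule_judg j js') js' /\ same_kind j (rule_judg j js').
Proof.
case=> [x a|G x M a b|M Gas|G D M N a bs c] F.
- by inversion F; split; [exact: R_var | ].
- inversion F as [ | ? j1 ? ? k1 F1]; inversion F1; subst.
  case: j1 k1 {F F1} => G1 M1 r1 [/= -> ->].
  by split; [exact: R_abs | ].
(* [rule_judg] inspects the subject before the result, so it reduces only once [M] is split. *)
- have -> : rule_judg (Judg (penv_cats (unzip1 Gas)) M
      (inr [seq LVar i | i <- unzip2 Gas])) js' = many_judg M js'.
    by case: M F.
  have [Gas' E] : exists Gas', js' =
      [seq Judg Ga.1 M (inl (LVar Ga.2)) | Ga : penv * pvar <- Gas'].
    elim: Gas js' F => [|Ga Gas IH] js' /= F.
      by inversion F; exists [::].
    inversion F as [ | ? j1 ? js1 k1 F1]; subst.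
    have [Gas' ->] := IH _ F1.
    case: j1 k1 {F} => G1 M1 r1 [/= -> ->].
    by exists ((G1, Ga.2) :: Gas').
  rewrite (rule_many E) E; split; first exact: R_many.
  by split=> //=; exists (unzip2 Gas').
- inversion F as [ | ? j1 ? ? k1 F1]; subst.
  inversion F1 as [ | ? j2 ? ? k2 F2]; subst; inversion F2; subst.
  case: j1 k1 {F} => G1 M1 r1 [/= -> ->].
  case: j2 k2 {F1 F2} => G2 M2 r2 [/= -> [bs' ->]].
  by split; [exact: R_app | ].
Qed.

(** Both claims are proved together: a node below a replaced (many) rule remains a rule instance
    because its new premises have the same kind as the old ones. *)
Lemma locally_pseudo_graft s N Ps P :
  List.Forall (is_PDmin N) Ps -> locally_pseudo P ->
  locally_pseudo (graft s N Ps P) /\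
  same_kind (concl P) (concl (graft s N Ps P)).
Proof.
move=> minPs; elim/tree_ind_Forall: P => j Qs IH /locally_pseudo_inv[rj lQs] /=.
case: ifP => [/andP[/eqP jN jr]|_].
  have [Gas E] : exists Gas, map (@concl _) Ps =
      [seq Judg Ga.1 N (inl (LVar Ga.2)) | Ga : penv * pvar <- Gas].
    elim: {IH} minPs => [|P {}Ps [_ _ [G [a PE]]] _ [Gas E]]; first by exists [::].
    by exists ((G, a) :: Gas); rewrite /= PE E.
  rewrite (rule_many E); split.
    constructor; first by rewrite E; exact: R_many.
    by apply: List.Forall_impl minPs => P [/pseudo_locally].
  split; first by rewrite jN.
  by case: (jres j) jr => //= t _; exists (unzip2 Gas).
have {IH lQs} F := Forall_imp2 (fun _ IHP => IHP) IH lQs.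
have F2 : List.Forall2 same_kind (map (@concl _) Qs)
    (map (@concl _) (map (graft s N Ps) Qs)).
  by elim: {rj} F => [|Q {}Qs [_ kQ] _ IHQs] /=; constructor.
have [r k] := rule_judg_instance rj F2.
split=> //; constructor=> //.
by elim: {rj F2 r k} F => [|Q {}Qs [lQ _] _ IHQs] /=; constructor.
Qed.

(** The renaming comes only after the last operation. It is left explicit here, to be absorbed later
    into the solving substitution instead of being commuted with [equations]. *)
Lemma apply_ops_locally os PE QF :
  apply_ops os PE QF -> locally_pseudo PE.1 -> PE.2 = equations PE.1 ->
  exists2 P, locally_pseudo P & renaming (P, equations P) QF.
Proof.
elim=> {os PE QF} [[P E] QF /= rQ lP E_|o os PE PE' QF oP _ IH lP E].
  by exists P; rewrite -?E_.
case: oP IH => [N Ps _ _ minPs _ _ Q|_] IH; last exact: IH.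
by apply: IH => //; have [] := locally_pseudo_graft (op_list o) minPs lP.
Qed.

(** * From solved equations to derivations in system N *)

Lemma solves_node psi j Ps :
  solves psi (equations (Node j Ps)) ->
  solves psi (rule_eqs j (map (@concl _) Ps)) /\
  List.Forall (fun P => solves psi (equations P)) Ps.
Proof.
(* The rule equations depend on [Ps]; generalizing them keeps them fixed during the induction on the
   premises. *)
rewrite /=; move: (rule_eqs j _) => R; elim: Ps => [|P Ps IH] /= sol.
  by split; [|constructor].
have [|sR sPs] := IH; first by move=> e eR; apply: sol; rewrite in_fsetU eR orbT.
by split=> //; constructor=> // e eP; apply: sol; rewrite in_fsetU eP.
Qed.

Section Derivation.
Variables (iota : pvar -> tvar) (phi : tvar -> ty) (psi : pvar -> pty).

(** The three maps of the theorem are fused, so that a single induction on the tree suffices. *)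
Let image (A : pty) : ty := tsubst phi (forget iota (psubst psi A)).
Let image_list (s : seq pty) : {mset ty} :=
  mset_subst phi (forget_list iota (map (psubst psi) s)).
Let image_env (G : penv) : nenv :=
  nenv_subst phi (forget_env iota (penv_subst psi G)).

(** [mset_subst] maps over an enumeration of a multiset, which is a permutation of the list it came
    from; [seq_mset] identifies the two. *)
Lemma image_listE s : image_list s = seq_mset (map image s).
Proof.
have -> : map image s =
    map (tsubst phi) (map (forget iota) (map (psubst psi) s)).
  by rewrite -!map_comp.
by apply/eq_seq_msetP; rewrite perm_map // perm_eq_seq_mset.
Qed.

Lemma image_envE G x : image_env G x = image_list (G x).
Proof.
(* Evaluating [env_map] off the support requires each of the three maps to send the empty list or
   multiset to the empty one. *)
have m0 : mset_subst phi mset0 = mset0.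
  by rewrite /mset_subst enum_mset0; exact: seq_mset0.
by rewrite /image_env !env_mapE //; exact: seq_mset0.
Qed.

Lemma image_list_nil : image_list [::] = mset0.
Proof. by rewrite image_listE seq_mset0. Qed.

Lemma image_env_cat G D :
  image_env (penv_cat G D) = nenv_sum (image_env G) (image_env D).
Proof.
apply/fsfunP => x; rewrite image_envE !env_opE ?mset0D // !image_envE.
by rewrite !image_listE map_cat seq_mset_cat.
Qed.

Lemma image_env_cats Gs :
  image_env (penv_cats Gs) = nenv_sums (map image_env Gs).
Proof.
elim: Gs => [|G Gs IH] /=; last by rewrite image_env_cat IH.
by apply/fsfunP => x; rewrite image_envE !fsfun0E image_list_nil.
Qed.

Lemma image_env1 x A :
  image_env (env1 [::] x [:: A]) = env1 mset0 x [mset image A].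
Proof.
apply/fsfunP => y; rewrite image_envE !env1E.
case: eqP => _; last exact: image_list_nil.
by rewrite image_listE; apply/msetP => B; rewrite mset_seqE msetnE /= addn0 eq_sym; case: eqP.
Qed.

Lemma image_env_rem G x : image_env (env_rem G x) = env_rem (image_env G) x.
Proof.
apply/fsfunP => y; rewrite image_envE !env_remE image_envE.
by case: eqP => // _; exact: image_list_nil.
Qed.

(** The equations of (abs) and (app) both have a variable on the left and an arrow on the right;
    solving one gives that variable the arrow type its rule needs. *)
Lemma image_arr b s A :
  psi b = LArr (map (psubst psi) s) (psubst psi A) ->
  image (LVar b) = arr (image_list s) (image A).
Proof. by rewrite /image /= => -> /=; rewrite tsubst_arr. Qed.

Lemma derivation_image P :
  locally_pseudo P -> solves psi (equations P) ->
  derivation (ntree_subst phi (forget_tree iota (ptree_subst psi P))).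
Proof.
pose im := jmap image_env image image_list.
have -> : ntree_subst phi (forget_tree iota (ptree_subst psi P)) = tree_map im P.
  rewrite /ntree_subst /forget_tree /ptree_subst !tree_map_comp.
  by apply: eq_tree_map => -[G M []].
elim/tree_ind_Forall: P => j Ps IH /locally_pseudo_inv[rj lPs].
move=> /solves_node[sj sPs].
have {IH lPs sPs} dPs : List.Forall derivation (map (tree_map im) Ps).
  have dPs := Forall_imp2 (fun _ IHP => IHP) IH lPs.
  have {IH lPs sPs rj sj dPs} := Forall_imp2 (fun _ dP => dP) dPs sPs.
  by elim=> [|P {}Ps dP _ IHPs]; constructor.
have cPs : map (@concl _) (map (tree_map im) Ps) =
    map im (map (@concl _) Ps).
  by rewrite -!map_comp; apply: eq_map => P; exact: concl_tree_map.
(* The mapped premises become a list [ts] known only by its conclusions and derivability, so that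
   case analysis on the rule can fix those conclusions. *)
rewrite /=; move: cPs dPs sj.
case: j (map (@concl _) Ps) / rj => [x a|G x M a b|M Gas|G D M N a bs c];
  move: (map _ Ps) => ts cts dts sj.
- case: ts cts dts => // _ _.
  by rewrite /im /jmap /= image_env1; exact: N_var.
- case: ts cts dts => [|t []] //= [ct] /List.Forall_cons_iff[dt _].
  (* [fset11] selects the single equation of (abs); the image of [G x] is then read as the value at
     [x] of the image environment, the form in [N_abs]. *)
  have /= /(@image_arr b (G x) (LVar a)) E := sj _ (fset11 _).
  rewrite /im /jmap /= image_env_rem E -image_envE.
  exact: N_abs dt ct.
- rewrite /im /jmap /= image_env_cats image_listE -!map_comp.
  pose GAs := [seq (image_env Ga.1, image (LVar Ga.2)) | Ga <- Gas].
  have := @N_many M GAs ts dts.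
  rewrite /unzip1 /unzip2 -!map_comp; apply.
  by rewrite cts -map_comp.
- case: ts cts dts => [|t [|u []]] //= [ct cu].
  move=> /List.Forall_cons_iff[dt /List.Forall_cons_iff[du _]].
  (* The equation of (app) turns the image of the variable [a] of the function into an arrow from
     the multiset assigned to the argument. *)
  have /= /(@image_arr a _ (LVar c)) E := sj _ (fset11 _).
  rewrite /im /jmap /= image_env_cat.
  apply: N_app dt _ du cu.
  by rewrite ct /im /jmap /= E.
Qed.

End Derivation.

(** * Absorbing the renaming, and the final assembly *)

Lemma psubst_comp (psi : pvar -> pty) r A :
  psubst psi (psubst (@LVar _ \o r) A) = psubst (psi \o r) A.
Proof.
elim/lty_ind_Forall: A => [a|s A IHs IHA] //=; rewrite IHA; congr LArr.
by elim: IHs => //= B {}s -> _ ->.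
Qed.

Lemma ptree_subst_comp (psi : pvar -> pty) r P :
  ptree_subst psi (ptree_subst (@LVar _ \o r) P) = ptree_subst (psi \o r) P.
Proof.
rewrite /ptree_subst tree_map_comp; apply: eq_tree_map => -[G M res].
have psubsts s :
    map (psubst psi) (map (psubst (@LVar _ \o r)) s) = map (psubst (psi \o r)) s.
  by rewrite -map_comp; apply: eq_map => A; exact: psubst_comp.
rewrite /jmap /=; congr Judg.
  by apply/fsfunP => x; rewrite !env_mapE.
by case: res => [A|s]; rewrite ?psubst_comp ?psubsts.
Qed.

Lemma solves_renaming psi r (E : eqset) :
  solves psi [fset equation_subst (@LVar _ \o r) e | e in E] ->
  solves (psi \o r) E.
Proof.
move=> sol e eE; have := sol _ (in_imfset _ (equation_subst (@LVar _ \o r)) eE).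
case: e {eE} => [[A B]|[s t]] /=; first by rewrite !psubst_comp.
by rewrite -!map_comp !(eq_map (psubst_comp psi r)).
Qed.

Theorem theorem3p10 :
  forall iota : pvar -> tvar, injective iota ->
  forall (M : term) (P : ptree) (E : eqset),
    pseudo_derivation M (P, E) ->
  forall (os : seq operation) (psi : pvar -> pty)
         (Q : ptree) (F : eqset),
    solution (P, E) os psi (Q, F) ->
  forall (G : penv) (a : pvar),
    concl Q = Judg G M (inl (LVar a)) ->
  forall phi : tvar -> ty,
    let t := ntree_subst phi (forget_tree iota (ptree_subst psi Q)) in
    derivation t /\
    concl t = Judg (nenv_subst phi (forget_env iota (penv_subst psi G))) M
                   (inl (tsubst phi (forget iota (psubst psi (LVar a))))).
Proof.
move=> iota _ M P E [pP _ EP] os psi Q F [_ opsQ sF] G a cQ phi t.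
split; last by rewrite /t /ntree_subst /forget_tree /ptree_subst !concl_tree_map cQ.
have [P' lP' [r [_ [Qr Fr]]]] := apply_ops_locally opsQ (pseudo_locally pP) EP.
(* Substituting by [psi] after renaming by [r] is substituting by [psi \o r], which solves the
   equations of the unrenamed tree [P']. *)
move: sF; rewrite /= /t Qr Fr ptree_subst_comp => /solves_renaming.
exact: derivation_image.
Qed.
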